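(* Let $s\ge 2$ be an integer with prime decomposition $s=p_1^{e_1}\cdots p_d^{e_d}$ (distinct primes $p_i$, exponents $e_i\ge 1$). Then, for any $i\in\{1,\dots,d\}$, the semigroup $\langle \mu_{p_i},\sigma\rangle\subset CAT(\Lambda_s^{\mathbb N})$ is ID if and only if $s$ is not a power of a prime.
   Context: $\mathbb N$ includes $0$. $\Lambda_s=\{0,1,\dots,s-1\}$ is the symbol set (discrete topology), and $\Lambda_s^{\mathbb N}$ is the space of one-sided sequences $a=a_0a_1a_2\dots$ with the product topology. $\sigma$ is the left shift, $\sigma(a)_k=a_{k+1}$. $CAT(\Lambda_s^{\mathbb N})$ is the semigroup (under composition) of all continuous maps $\tau:\Lambda_s^{\mathbb N}\to\Lambda_s^{\mathbb N}$ with $\tau\sigma=\sigma\tau$ (cellular automata transformations). For a prime $p$ dividing $s$, $\mu_p\in CAT(\Lambda_s^{\mathbb N})$ is defined by $\mu_p(a)_k=\left(p\,a_k+\left\lfloor \frac{p\,a_{k+1}}{s}\right\rfloor\right) \bmod s$. $\langle \tau_1,\dots,\tau_n\rangle$ denotes the semigroup generated by $\tau_1,\dots,\tau_n$ under composition. A semigroup $\Sigma\subset CAT(\Lambda_s^{\mathbb N})$ is ID (has the ID property) if every closed $\Sigma$-invariant proper subset of $\Lambda_s^{\mathbb N}$ is finite; a set $A$ is $\Sigma$-invariant if $\tau(A)\subset A$ for all $\tau\in\Sigma$. *)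

(* Defs.v *)
From mathcomp Require Import all_boot all_order all_algebra.
From mathcomp Require Import all_classical topology.

Set Implicit Arguments.
Unset Strict Implicit.
Unset Printing Implicit Defensive.

Local Open Scope nat_scope.
Local Open Scope classical_set_scope.

Definition symb_seq (s : nat) : topologicalType :=
  prod_topology (fun _ : nat => discrete_topology 'I_s).

Section CellularAutomata.
Variable s : nat.
Implicit Types (a : symb_seq s) (Sigma : set (symb_seq s -> symb_seq s)).

Definition shift (a : symb_seq s) : symb_seq s := fun k => a k.+1.

Definition CAT : set (symb_seq s -> symb_seq s) :=
  [set tau | continuous tau /\ tau \o shift = shift \o tau].

(* A point [a] of the sequence space itself witnesses [0 < s], so no positivity
   hypothesis on [s] is needed to reduce modulo [s]. *)
Lemma symb_seq_gt0 (a : symb_seq s) : 0 < s.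
Proof. exact: leq_ltn_trans (leq0n _) (ltn_ord (a 0 : 'I_s)). Qed.

Definition mu (p : nat) (a : symb_seq s) : symb_seq s := fun k =>
  Ordinal (ltn_pmod (p * (a k : 'I_s) + (p * (a k.+1 : 'I_s)) %/ s)
                    (symb_seq_gt0 a)).

Definition semigroup Sigma : Prop :=
  forall tau rho, Sigma tau -> Sigma rho -> Sigma (tau \o rho).

Definition generated_semigroup (G : set (symb_seq s -> symb_seq s)) :=
  smallest semigroup G.

Definition invariant_set Sigma (A : set (symb_seq s)) : Prop :=
  forall tau, Sigma tau -> tau @` A `<=` A.

Definition ID Sigma : Prop :=
  forall A : set (symb_seq s),
    closed A -> invariant_set Sigma A -> A `<` setT -> finite_set A.

Lemma continuous_coord k : continuous (fun a => a k : discrete_topology 'I_s).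
Proof. exact: (@proj_continuous nat (fun=> discrete_topology 'I_s) k). Qed.

Lemma continuous_local (f : symb_seq s -> symb_seq s) :
  (forall k a, \forall b \near a, f b k = f a k) -> continuous f.
Proof.
move=> fP a; have FF : Filter (f @ a) by exact: (fmap_filter f (nbhs_filter a)).
apply/cvg_sup => k U [/= _ [[V /= oV <-] /= Vfa]] /filterS.
apply; apply: filterS (fP k a) => b /= E; rewrite /proj /=; move: Vfa.
by rewrite /proj /= E.
Qed.

Lemma near_coord k a : \forall b \near a, b k = a k.
Proof. exact: (@continuous_coord k a [set a k] (discrete_set1 _)). Qed.

Lemma shift_CAT : CAT shift.
Proof. by split=> //; apply: continuous_local => k a; exact: near_coord. Qed.

Lemma mu_CAT p : CAT (mu p).
Proof.
split.
  apply: continuous_local => k a.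
  apply: filterS2 (near_coord k a) (near_coord k.+1 a) => b e1 e2.
  by apply: val_inj; rewrite /mu /= e1 e2.
by apply/funext => a; apply/funext => k; apply: val_inj.
Qed.

Lemma CAT_semigroup : semigroup CAT.
Proof.
move=> tau rho [ct st] [cr sr]; split.
  by move=> a; apply: continuous_comp; [exact: cr | exact: ct].
by rewrite -compA sr compA st.
Qed.

Lemma generated_semigroup_CAT p :
  generated_semigroup [set mu p; shift] `<=` CAT.
Proof.
by apply: smallest_sub CAT_semigroup _ => _ [->|->];
  [exact: mu_CAT | exact: shift_CAT].
Qed.

End CellularAutomata.

Arguments shift : clear implicits.
Arguments mu : clear implicits.

(* Main.v *)
(* Reading a sequence as the base-s expansion of a real number turns [shift]
   into multiplication by s and [mu p] into multiplication by p modulo 1.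

   If s is not a prime power, p and s are multiplicatively independent, and
   every infinite closed invariant set of sequences is everything by
   Furstenberg's theorem on closed subsets of the circle invariant under
   multiplication by p and s, because a real number has at most two expansions.
   Furstenberg's theorem is proved as in Boshernitzan's elementary account.  The
   numbers p^a s^b are nonlacunary, so an invariant closed set accumulating at
   0, and then at any rational, is the whole circle.  If the set X of limit
   points had no rational point, the difference set of any nonempty closed
   invariant subset would be everything; for N prime to p s, intersecting
   repeatedly with the translate by 1/N then yields x, x + 1/N, x + 2/N, etc.
   in X, so X would come arbitrarily close to 0, hence contain 0.

   If s = p^e, then [mu p] acts as the shift on base-p digits, and the sequences
   with at most one nonzero base-p digit, equal to 1, form an infinite proper
   closed invariant set. *)

From mathcomp Require Import all_boot all_order all_algebra cyclic.
From mathcomp Require Import all_classical reals topology normedtype sequences.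
From mathcomp Require Import Rstruct zify ring lra.
(* After [normedtype], which has its own [shift]. *)
Require Import Defs.

Set Implicit Arguments.
Unset Strict Implicit.
Unset Printing Implicit Defensive.

Import Order.TTheory GRing.Theory Num.Theory numFieldNormedType.Exports.

(** * Nonlacunarity *)

(** For [p, q > 1] this is the irrationality of log p / log q, since [a = 0] forces [b = 0] as
    well. *)
Definition mult_indep (p q : nat) : Prop :=
  forall a b : nat, (p ^ a = q ^ b -> a = 0)%N.

Definition smooth (p q t : nat) : Prop :=
  exists a b : nat, t = (p ^ a * q ^ b)%N.

Lemma smoothM p q t u : smooth p q t -> smooth p q u -> smooth p q (t * u).
Proof.
move=> [a [b ->]] [a' [b' ->]]; exists (a + a')%N, (b + b')%N.
by rewrite !expnD mulnACA.
Qed.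

Lemma smoothX p q t n : smooth p q t -> smooth p q (t ^ n).
Proof.
move=> [a [b ->]]; exists (a * n)%N, (b * n)%N.
by rewrite expnMn -!expnM.
Qed.

Lemma mult_indepX p q u : (0 < u)%N -> mult_indep p q ->
  mult_indep (p ^ u) (q ^ u).
Proof.
move=> u0 ind a b; rewrite -!expnM => /ind /eqP.
by rewrite muln_eq0 (gtn_eqF u0) => /eqP.
Qed.

Section Nonlacunary.
Variable R : realType.
Local Open Scope ring_scope.

(** Pigeonhole: dividing by [d] and truncating sends the first [K.+2] terms to at most [K.+1]
    values. *)
Lemma close_pair (f : nat -> R) (M d : R) : 0 < d ->
  (forall i, 0 <= f i <= M) -> exists i j, (i < j)%N /\ `|f i - f j| < d.
Proof.
move=> d0 fM; apply: contrapT => H.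
have far i j : (i < j)%N -> d <= `|f i - f j|.
  by move=> ij; rewrite leNgt; apply/negP => lt; apply: H; exists i, j.
pose K := Num.truncn (M / d).
have fd0 i : 0 <= f i / d by apply: divr_ge0 (ltW d0); case/andP: (fM i).
have fK i : (Num.truncn (f i / d) < K.+1)%N.
  rewrite ltnS truncn_le_nat (le_lt_trans _ (truncnS_gt _)) //.
  by rewrite ler_pM2r ?invr_gt0 //; case/andP: (fM i).
pose g (i : 'I_K.+2) := Ordinal (fK i).
have ginj : injective g.
  move=> i j /(congr1 val) /= E; apply/val_inj => /=.
  have := truncn_itv (fd0 i); have := truncn_itv (fd0 j); rewrite E.
  set t := Num.truncn _ => /andP[a1 a2] /andP[b1 b2].
  have lt1 : `|f i - f j| < d.
    have -> : f i - f j = (f i / d - f j / d) * d by field; rewrite gt_eqF.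
    rewrite normrM (gtr0_norm d0) gtr_pMl // ltr_norml.
    rewrite -natr1 in a2 b2; apply/andP; split; lra.
  case: (ltngtP i j) => // ij; have := far _ _ ij; last rewrite distrC.
    by rewrite leNgt lt1.
  by rewrite leNgt lt1.
by have := leq_card _ ginj; rewrite !card_ord ltnn.
Qed.

(* Pigeonhole on the numbers p^m / q^(e m) in [1, q]. *)
Lemma smooth_ratio_near1 p q (rho : R) : (1 < p)%N -> (1 < q)%N ->
  mult_indep p q -> 1 < rho ->
  exists P Q : nat, [/\ smooth p q P, smooth p q Q, (1 < Q)%N,
    (Q%:R : R) < P%:R & P%:R < rho * Q%:R].
Proof.
move=> p1 q1 ind rho1.
have p0 : (0 < p)%N by exact: ltnW.
have q0 : (0 < q)%N by exact: ltnW.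
pose e m := trunc_log q (p ^ m).
have px m : (0 < p ^ m)%N by rewrite expn_gt0 p0.
have qx m : (0 < q ^ m)%N by rewrite expn_gt0 q0.
have qxR m : 0 < (q ^ m)%:R :> R by rewrite ltr0n.
pose u m : R := (p ^ m)%:R / (q ^ e m)%:R.
have u_ge1 m : 1 <= u m.
  by rewrite ler_pdivlMr // mul1r ler_nat trunc_logP.
have uq m : 0 <= u m <= q%:R.
  rewrite (le_trans _ (u_ge1 m)) //= ler_pdivrMr // -natrM ler_nat -expnS.
  by rewrite ltnW // trunc_log_ltn.
have [i [j [ij ud]]] := @close_pair u _ (rho - 1) ltac:(lra) uq.
have neq : u i != u j.
  apply/negP; have nz m : (q ^ m)%:R != 0 :> R by rewrite gt_eqF.
  rewrite /u eqr_div //.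
  rewrite -!natrM eqr_nat => /eqP.
  rewrite -[in (p ^ j)%N](subnKC (ltnW ij)) expnD -mulnA => /eqP;
    rewrite eqn_pmul2l // => /eqP E.
  have le_e : (e i <= e j)%N.
    by rewrite /e leq_trunc_log // leq_pexp2l // ltnW.
  move: E; rewrite -(subnK le_e) expnD => /eqP; rewrite eqn_pmul2r // => /eqP.
  by move/esym/ind/eqP; rewrite subn_eq0 leqNgt ij.
have main a b : u a < u b -> u b - u a < rho - 1 ->
  exists P Q : nat, [/\ smooth p q P, smooth p q Q, (1 < Q)%N,
    (Q%:R : R) < P%:R & P%:R < rho * Q%:R].
  (* The quotient P / Q is [u b / u a], which is below [rho] because [u a >= 1]. The extra factor
     [p] in both ensures [Q > 1]. *)
  move=> lt1 lt2; exists (p ^ b.+1 * q ^ e a)%N, (p ^ a.+1 * q ^ e b)%N.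
  have k0 : 0 < p%:R * (q ^ e a)%:R * (q ^ e b)%:R :> R.
    by rewrite -!natrM ltr0n !muln_gt0 p0 !qx.
  have EP : (p ^ b.+1 * q ^ e a)%:R =
    u b * (p%:R * (q ^ e a)%:R * (q ^ e b)%:R).
    by rewrite /u expnS !natrM; field; rewrite gt_eqF.
  have EQ : (p ^ a.+1 * q ^ e b)%:R =
    u a * (p%:R * (q ^ e a)%:R * (q ^ e b)%:R).
    by rewrite /u expnS !natrM; field; rewrite gt_eqF.
  split; [by exists b.+1, (e a) | by exists a.+1, (e b) | | |].
  - by rewrite expnS -mulnA (leq_trans p1) // leq_pmulr // muln_gt0 px qx.
  - by rewrite EP EQ ltr_pM2r.
  - rewrite EP EQ [rho * _]mulrA ltr_pM2r //; have := u_ge1 a.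
    by nra.
move: neq; rewrite neq_lt => /orP[] lt.
  by apply: (main i j) => //; move: ud; rewrite distrC gtr0_norm ?subr_gt0.
by apply: (main j i) => //; move: ud; rewrite gtr0_norm ?subr_gt0.
Qed.

(** The step that first reaches [v] starts below [v], so it overshoots by a factor of at most
    [rho]. *)
Lemma small_steps (f : nat -> R) (rho v : R) k : 1 <= rho -> 0 <= v ->
  f 0%N <= v -> v <= f k -> (forall j, (j < k)%N -> f j.+1 <= rho * f j) ->
  exists2 j, (j <= k)%N & v <= f j <= rho * v.
Proof.
move=> rho1 v0 f0; elim: k => [|k IH] fk step.
  by exists 0%N => //; rewrite fk (le_trans f0) // ler_peMl.
have [vk|kv] := leP v (f k).
  have [j jk jv] := IH vk (fun j jk => step j (ltnW jk)).
  by exists j => //; rewrite (leq_trans jk).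
exists k.+1 => //; rewrite fk (le_trans (step k _)) // ler_pM2l ?ltW //.
by rewrite (lt_le_trans _ rho1).
Qed.

Lemma bernoulli_le (c : R) n : 0 <= c -> 1 + n%:R * c <= (1 + c) ^+ n.
Proof.
move=> c0; elim: n => [|n IH]; first by rewrite expr0 mul0r addr0.
rewrite exprS (le_trans _ (ler_wpM2l _ IH)) ?addr_ge0 //.
rewrite -natr1; have : 0 <= n%:R :> R by [].
nra.
Qed.

(* For 1 < P / Q < rho the progression P^j Q^(k-j), 0 <= j <= k, goes from Q^k to
   P^k, and these ranges overlap once Q^(k+1) <= P^k. *)
Lemma smooth_nonlacunary p q (rho : R) : (1 < p)%N -> (1 < q)%N ->
  mult_indep p q -> 1 < rho ->
  exists2 T : R, 0 < T &
    forall v, T <= v -> exists2 t : nat, smooth p q t & v <= t%:R <= rho * v.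
Proof.
move=> p1 q1 ind rho1.
have [P [Q [sP sQ Q1 QP Prho]]] := smooth_ratio_near1 p1 q1 ind rho1.
have Q0 : 0 < Q%:R :> R by rewrite ltr0n ltnW.
pose c : R := P%:R / Q%:R - 1.
have c0 : 0 < c by rewrite subr_gt0 ltr_pdivlMr // mul1r.
(* By Bernoulli's inequality, [k > Q / c] gives (P / Q)^k >= Q, which is the overlap condition. *)
pose K := Num.truncn (Q%:R / c : R).
have big k : (K < k)%N -> (Q%:R : R) ^+ k.+1 <= P%:R ^+ k.
  move=> Kk; have -> : P%:R = Q%:R * (1 + c) :> R by rewrite /c; field;
    rewrite gt_eqF.
  rewrite exprMn exprSr ler_pM2l ?exprn_gt0 //.
  apply: le_trans (bernoulli_le k (ltW c0)).
  have := truncnS_gt (Q%:R / c : R); rewrite -/K ltr_pdivrMr // => lt.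
  have : (K.+1%:R : R) <= k%:R by rewrite ler_nat.
  by nra.
exists (Q%:R ^+ K.+1) => [|v Tv]; first by rewrite exprn_gt0.
have v0 : 0 < v by rewrite (lt_le_trans _ Tv) // exprn_gt0.
pose n := Num.truncn v; pose k := trunc_log Q n.
have Tn : (Q ^ K.+1 <= n)%N by rewrite truncn_ge_nat ?(ltW v0) // natrX.
have n0 : (0 < n)%N by rewrite (leq_trans _ Tn) // expn_gt0 ltnW.
have Qv : Q%:R ^+ k <= v.
  by rewrite -natrX -truncn_ge_nat ?(ltW v0) // trunc_logP.
have vQ : v < Q%:R ^+ k.+1.
  by rewrite -natrX -truncn_lt_nat ?(ltW v0) // trunc_log_ltn.
have Kk : (K < k)%N by rewrite trunc_log_max.
pose f j : R := P%:R ^+ j * Q%:R ^+ (k - j).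
have [|||j jk jv] := @small_steps f rho v k (ltW rho1) (ltW v0).
- by rewrite /f expr0 mul1r subn0.
- by rewrite /f subnn expr0 mulr1 (le_trans (ltW vQ)) // big.
- move=> j jk; rewrite /f -(subnSK jk) !exprS.
  set A := P%:R ^+ j; set B := Q%:R ^+ _.
  have AB0 : 0 <= A * B by rewrite mulr_ge0 ?exprn_ge0.
  by have := ler_wpM2r AB0 (ltW Prho); lra.
exists (P ^ j * Q ^ (k - j))%N; last by rewrite natrM !natrX.
by apply: smoothM; exact: smoothX.
Qed.

End Nonlacunary.

(** * Furstenberg's theorem *)

Section Furstenberg.
Variable R : realType.
Local Open Scope ring_scope.
Local Open Scope classical_set_scope.
Implicit Types (X : set R) (p q : nat).

(** A subset of the circle R/Z is represented by its 1-periodic preimage in R. *)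
Definition circle_invariant p q X : Prop :=
  forall x, X x -> [/\ X (x + 1), X (x - 1), X (p%:R * x) & X (q%:R * x)].

Lemma circle_invariant_int p q X x (m : int) : circle_invariant p q X ->
  X x -> X (x + m%:~R).
Proof.
move=> inv Xx; elim/int_ind: m => [|n IH|n IH].
- by rewrite addr0.
- have [+ _ _ _] := inv _ IH.
  by rewrite -!pmulrn -natr1 addrA.
- have [_ + _ _] := inv _ IH.
  by rewrite !intrN -!pmulrn -natr1 opprD addrA.
Qed.

Lemma circle_invariant_smooth p q X t x : circle_invariant p q X ->
  smooth p q t -> X x -> X (t%:R * x).
Proof.
move=> inv [a [b ->]] Xx; rewrite natrM !natrX.
have Xb : X (q%:R ^+ b * x).
  elim: b => [|b IH]; first by rewrite mul1r.
  by rewrite exprS -mulrA; have [] := inv _ IH.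
elim: a => [|a IH]; first by rewrite mul1r.
by rewrite exprS -!mulrA [_ ^+ a * _]mulrA; have [] := inv _ IH.
Qed.

(** Passing to powers allows both multipliers to be 1 modulo a number prime to them, by Euler's
    theorem. *)
Lemma circle_invariantX p q X u : circle_invariant p q X ->
  circle_invariant (p ^ u) (q ^ u) X.
Proof.
move=> inv x Xx; have [? ? _ _] := inv _ Xx; split => //.
  by apply: (circle_invariant_smooth inv _ Xx); exists u, 0%N; rewrite muln1.
by apply: (circle_invariant_smooth inv _ Xx); exists 0%N, u; rewrite mul1n.
Qed.

Lemma closed_approx X y : closed X ->
  (forall d : R, 0 < d -> exists2 z, X z & `|z - y| < d) -> X y.
Proof.
move=> cX H; apply: cX => U /nbhs_ballP[d d0 sub].
have [z Xz zy] := H _ d0; exists z; split => //.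
by apply: sub; rewrite /ball /= distrC.
Qed.

Lemma dense_of_small_pos p q X : (1 < p)%N -> (1 < q)%N -> mult_indep p q ->
  circle_invariant p q X ->
  (forall d : R, 0 < d -> exists2 x, X x & 0 < x < d) ->
  forall y d : R, 0 < d -> exists2 z, X z & `|z - y| < d.
Proof.
move=> p1 q1 ind inv small y d d0.
(* With the target in [1, 2), a point [x < 1 / T] makes [y' / x] at least [T], and the error of
   [t * x] is at most [(d / 2) * y' < d]. *)
pose y' := y - (Num.floor y)%:~R + 1.
have /andP[y'1 y'2] : 1 <= y' < 2.
  have /andP[] := floor_itv y; rewrite intrD /y' => ? ?.
  by apply/andP; split; lra.
have [T T0 HT] := @smooth_nonlacunary R p q (1 + d / 2) p1 q1 ind ltac:(lra).
have [x Xx /andP[x0 xT]] := small T^-1 ltac:(by rewrite invr_gt0).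
have Ty : T <= y' / x.
  rewrite ler_pdivlMr // (le_trans _ y'1) //.
  by rewrite mulrC -ler_pdivlMr // div1r ltW.
have [t st /andP[t1 t2]] := HT _ Ty.
exists (t%:R * x + (Num.floor y - 1)%:~R).
  by apply: (circle_invariant_int _ inv);
    exact: circle_invariant_smooth inv st Xx.
have -> : t%:R * x + (Num.floor y - 1)%:~R - y = t%:R * x - y'.
  by rewrite /y' intrB; ring.
move: t1 t2; rewrite ler_pdivrMr // mulrA ler_pdivlMr // => t1 t2.
rewrite ger0_norm ?subr_ge0 //; nra.
Qed.

(** Either X or its mirror image has arbitrarily small positive points, so [dense_of_small_pos]
    applies to one of them. *)
Lemma full_of_small p q X : (1 < p)%N -> (1 < q)%N -> mult_indep p q ->
  closed X -> circle_invariant p q X ->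
  (forall d : R, 0 < d -> exists2 x, X x & 0 < `|x| < d) -> forall y, X y.
Proof.
move=> p1 q1 ind cX inv small y; apply: (closed_approx cX) => d d0.
have [H|H] := pselect (forall e : R, 0 < e -> exists2 x, X x & 0 < x < e).
  exact: (dense_of_small_pos p1 q1 ind inv H).
have invN : circle_invariant p q (-%R @^-1` X).
  move=> x /= Xx; have [X1 X2 X3 X4] := inv _ Xx; split.
  - by rewrite /= opprD.
  - by rewrite /= opprD opprK.
  - by rewrite /= -mulrN.
  - by rewrite /= -mulrN.
have smallN e : 0 < e -> exists2 x, X (- x) & 0 < x < e.
  move=> e0; have [e' [e'0 He']] : exists e', 0 < e' /\
      forall x, X x -> 0 < x < e' -> False.
    apply: contrapT => H'; apply: H => e' e'0; apply: contrapT => H2.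
    by apply: H'; exists e'; split => // x Xx xe; apply: H2; exists x.
  have [x Xx /andP[x0 xe]] :=
    small (Order.min e e') ltac:(by rewrite lt_min e0 e'0).
  move: xe; rewrite lt_min => /andP[xe xe'].
  exists (- x); rewrite ?opprK //.
  have [x_ge0|x_lt0] := leP 0 x.
    by move: x0 xe'; rewrite ger0_norm // => x0 xe'; case: (He' x Xx);
      rewrite x0 xe'.
  by move: x0 xe; rewrite ltr0_norm // => -> ->.
have [z Xz zy] := dense_of_small_pos p1 q1 ind invN smallN (- y) d0.
by exists (- z) => //; rewrite -opprD normrN; move: zy; rewrite opprK.
Qed.

(** This is the difference set F - K. Near [y], boundedness of K leaves only a compact piece of F
    relevant, and a difference of compact sets is compact. *)
Lemma closed_translates (K F : set R) : compact K -> closed F ->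
  closed [set y | exists2 k, K k & F (k + y)].
Proof.
move=> cK cF y cly.
have [M [_ HM]] := compact_bounded cK.
pose b : R := `|M| + 1.
have Kb k : K k -> `|k| <= b.
  by apply: HM; rewrite /b (le_lt_trans (ler_norm M)) // ltrDl.
pose F' := F `&` `[y - 1 - b, y + 1 + b]%classic.
have cF' : compact F' by rewrite /F' setIC; apply: compact_closedI cF;
  exact: segment_compact.
pose C := (fun z : R * R => z.2 - z.1) @` (K `*` F').
have cC : closed C.
  apply: compact_closed; first exact: norm_hausdorff.
  apply: continuous_compact; last exact: compact_setX.
  apply: continuous_subspaceT => z.
  by apply: cvgB; [exact: cvg_snd | exact: cvg_fst].
suff : C y.
  move=> [[k f] /= [Kk [Ff _]] <-]; exists k => //.
  by rewrite addrC subrK.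
apply: cC => U nU.
have nb : nbhs y (U `&` ball y 1) by apply: filterI nU _; exact: nbhsx_ballx.
have [z [[k Kk Fk] [Uz yz]]] := cly _ nb.
exists z; split => //; exists (k, k + z) => /=; last by rewrite addrC addKr.
split => //; split => //=; rewrite in_itv /=.
move: (Kb _ Kk) yz;
  rewrite /ball /= ler_norml ltr_norml => /andP[? ?] /andP[? ?].
by apply/andP; split; lra.
Qed.

Lemma closed_translate X b : closed X -> closed [set x | X (x + b)].
Proof.
apply: (@preimage_closed _ _ (fun x : R => x + b)) => x _.
by apply: cvgD; [exact: cvg_id | exact: cvg_cst].
Qed.

Lemma closed_int : closed [set x : R | x \is a Num.int].
Proof.
move=> x clx; apply: contrapT => /= /negP xZ.
have /andP[f1 f2] := floor_itv x.
have f1' : (Num.floor x)%:~R < x by rewrite lt_neqAle f1 -intrEfloor xZ.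
have e0 : 0 < Order.min (x - (Num.floor x)%:~R) ((Num.floor x + 1)%:~R - x).
  by rewrite lt_min !subr_gt0 f1' f2.
have [z [/= /intrP[m ->]]] := clx _ (nbhsx_ballx x _ e0).
rewrite /ball /= lt_min !ltr_norml => /andP[/andP[_ m1] /andP[m2 _]].
have : (Num.floor x)%:~R < m%:~R :> R by lra.
have : m%:~R < (Num.floor x + 1)%:~R :> R by lra.
by rewrite !ltr_int; lia.
Qed.

Definition irrational_set X : Prop :=
  forall x (n : nat), X x -> (0 < n)%N -> n%:R * x \isn't a Num.int.

(** The difference set is closed and invariant. Pigeonhole on the orbit [p ^ n * x0] modulo 1 gives
    arbitrarily small differences, nonzero because [x0] is irrational, so [full_of_small]
    applies. *)
Lemma difference_full p q X : (1 < p)%N -> (1 < q)%N -> mult_indep p q ->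
  closed X -> circle_invariant p q X -> irrational_set X -> X !=set0 ->
  forall y, exists2 x, X x & X (x + y).
Proof.
move=> p1 q1 ind cX inv irr [x0 Xx0].
pose K := `[0, 1]%classic `&` X.
have cK : compact K by apply: compact_closedI => //; exact: segment_compact.
have Xfl x : X x -> X (x - (Num.floor x)%:~R).
  by move=> Xx; rewrite -intrN; exact: (circle_invariant_int _ inv).
have fl01 (x : R) : 0 <= x - (Num.floor x)%:~R <= 1.
  by have /andP[] := floor_itv x; rewrite intrD => ? ?; apply/andP; split; lra.
(* By periodicity one of the two points may be taken in the compact set [K], which makes the
   difference set closed. *)
have ED : [set y | exists2 k, K k & X (k + y)] =
  [set y | exists2 x, X x & X (x + y)].
  apply/seteqP; split => y /= [x]; first by move=> [_ Xx] Xxy; exists x.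
  move=> Xx Xxy; exists (x - (Num.floor x)%:~R).
    by split; [rewrite /= in_itv; exact: fl01 | exact: Xfl].
  by rewrite addrAC -intrN; exact: (circle_invariant_int _ inv).
apply: (@full_of_small p q [set y | exists2 x, X x & X (x + y)] p1 q1 ind).
- by rewrite -ED; exact: closed_translates.
- move=> y [x Xx Xxy]; have [X1 X2 X3 X4] := inv _ Xxy.
  have [_ _ X3' X4'] := inv _ Xx.
  split; [exists x|exists x|exists (p%:R * x)|exists (q%:R * x)] => //.
  + by rewrite addrA.
  + by rewrite addrA.
  + by rewrite -mulrDr.
  + by rewrite -mulrDr.
- move=> d d0; pose g n : R := (p ^ n)%:R * x0.
  have Xg n : X (g n).
    by apply: (circle_invariant_smooth inv _ Xx0); exists n, 0%N; rewrite muln1.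
  have [i [j [ij fij]]] := close_pair d0 (fun n => fl01 (g n)).
  set fi := g i - _ in fij; set fj := g j - _ in fij.
  exists (fj - fi); last first.
    rewrite -(distrC fi) fij andbT normr_gt0 subr_eq0; apply/negP => /eqP E.
    have lt : (p ^ i < p ^ j)%N by rewrite ltn_exp2l.
    have /negP := irr x0 (p ^ j - p ^ i)%N Xx0 ltac:(by rewrite subn_gt0).
    apply; rewrite natrB ?(ltnW lt) // mulrBl -/(g i) -/(g j).
    have -> : g j - g i = (Num.floor (g j))%:~R - (Num.floor (g i))%:~R.
      by move: E; rewrite /fi /fj => E; lra.
    by rewrite rpredB // intr_int.
  exists fi; first exact: Xfl.
  by rewrite addrC subrK; exact: Xfl.
Qed.

(* As P = Q = 1 mod N, multiplication by P or Q commutes with translation by 1/N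
   modulo 1, so X and its translate intersect in a set of the same kind, nonempty
   by [difference_full]. *)
Lemma arithmetic_chain N P Q X i : (0 < N)%N -> (1 < P)%N -> (1 < Q)%N ->
  (N %| P - 1)%N -> (N %| Q - 1)%N -> mult_indep P Q ->
  closed X -> circle_invariant P Q X -> irrational_set X -> X !=set0 ->
  exists x, forall j, (j <= i)%N -> X (x + j%:R / N%:R).
Proof.
move=> N0 P1 Q1 NP NQ ind.
have NR : N%:R != 0 :> R by rewrite pnatr_eq0 -lt0n.
elim: i X => [|i IH] X cX inv irr X0.
  have [x Xx] := X0; exists x => j; rewrite leqn0 => /eqP ->.
  by rewrite mul0r addr0.
pose X1 := X `&` [set x | X (x + N%:R^-1)].
have mulN t x : (0 < t)%N -> (N %| t - 1)%N -> X (t%:R * (x + N%:R^-1)) ->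
    X (t%:R * x + N%:R^-1).
  move=> t0 /dvdnP[k E]; have -> : t = (k * N).+1 by rewrite -E subn1 prednK.
  move=> /(circle_invariant_int (- k%:Z) inv).
  rewrite (_ : _ + _ = (k * N).+1%:R * x + N%:R^-1) //.
  by rewrite intrN -pmulrn -natr1 natrM; field.
have [||||x Hx] := IH X1.
- by apply: closedI => //; exact: closed_translate.
- move=> x [Xx Xx']; have [a1 a2 a3 a4] := inv _ Xx;
  have [b1 b2 b3 b4] := inv _ Xx'.
  split; split => //=; try by rewrite addrAC.
  + by apply: mulN => //; exact: ltnW.
  + by apply: mulN => //; exact: ltnW.
- by move=> x n [Xx _]; exact: irr.
- by have [x] := difference_full P1 Q1 ind cX inv irr X0 N%:R^-1; exists x.
(* A chain in [X1] extends by one more step in X. *)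
exists x => -[|j] ji; first by have [] := Hx 0%N isT.
have [_] := Hx j ji; rewrite /= -natr1 => H.
by rewrite mulrDl mul1r addrA.
Qed.

Lemma no_irrational_invariant_set p q X : (1 < p)%N -> (1 < q)%N ->
  mult_indep p q -> closed X -> circle_invariant p q X -> irrational_set X ->
  ~ (X !=set0).
Proof.
move=> p1 q1 ind cX inv irr X0.
suff X00 : X 0.
  by have := irr 0 1%N X00 isT; rewrite mulr0 rpred0.
apply: (closed_approx cX) => d d0.
have [N [N0 copp copq Nd]] : exists N, [/\ (0 < N)%N, coprime p N, coprime q N &
    (N%:R : R)^-1 < d].
  (* A successor of a multiple of [p * q] is prime to both; the last factor makes it exceed
     [d^-1]. *)
  exists (p * q * Num.truncn d^-1).+1; split => //.
  - by rewrite -mulnA; apply: coprime_dvdl (coprimenS _); exact: dvdn_mulr.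
  - by rewrite mulnAC; apply: coprime_dvdl (coprimenS _); exact: dvdn_mull.
  - rewrite -[d]invrK ltf_pV2 ?posrE ?invr_gt0 // invrK.
    apply: lt_le_trans (truncnS_gt _) _; rewrite ler_nat ltnS.
    by rewrite leq_pmull // muln_gt0 (ltnW p1) (ltnW q1).
pose u := totient N.
have u0 : (0 < u)%N by rewrite totient_gt0.
have big m : (1 < m)%N -> (1 < m ^ u)%N.
  by move=> m1; rewrite -(exp1n u) ltn_exp2r.
have div m : (1 < m)%N -> coprime m N -> (N %| m ^ u - 1)%N.
  move=> m1 c; rewrite -eqn_mod_dvd ?(ltnW (big _ m1)) //.
  by apply/eqP; exact: Euler_exp_totient.
have [x Hx] := arithmetic_chain N N0 (big p p1) (big q q1) (div p p1 copp)
  (div q q1 copq) (mult_indepX u0 ind) cX (circle_invariantX u inv) irr X0.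
have NR : 0 < N%:R :> R by rewrite ltr0n.
have /andP[f1 f2] := floor_itv x; rewrite intrD in f2.
pose y := x - (Num.floor x + 1)%:~R.
have /andP[y1 y2] : -1 <= y <= 0 by rewrite /y intrD; apply/andP; split; lra.
have yN : 0 <= - y * N%:R by rewrite mulr_ge0 // oppr_ge0.
(* The chain starts at [y] in [-1, 0] and advances by 1 / N; [j] is the last index not past 0, so
   that point is within 1 / N of 0. *)
pose j := Num.truncn (- y * N%:R).
have jN : (j <= N)%N.
  by rewrite truncn_le_nat -natr1; nra.
exists (y + j%:R / N%:R).
  rewrite /y -intrN addrAC; apply: (circle_invariant_int _ inv); exact: Hx.
have /andP[j1 j2] := truncn_itv yN; rewrite -/j -natr1 in j1 j2.
have Nd' : 1 < d * N%:R by rewrite -ltr_pdivrMr // div1r.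
have E : (y + j%:R / N%:R) * N%:R = y * N%:R + j%:R by field; rewrite gt_eqF.
rewrite subr0 ltr_norml -(ltr_pM2r NR) -[X in _ && X](ltr_pM2r NR) E.
by apply/andP; split; lra.
Qed.

(* Multiplying by q^n clears the part of the denominator of r not prime to q.
   With n2 the remaining part, powers of p and q that are 1 mod n2 fix the image
   of r, which can thus be translated to 0. *)
Lemma full_of_rational_limit p q X r (n : nat) : (1 < p)%N -> (1 < q)%N ->
  (p %| q)%N -> mult_indep p q -> closed X -> circle_invariant p q X ->
  (0 < n)%N -> n%:R * r \is a Num.int ->
  (forall d : R, 0 < d -> exists2 x, X x & 0 < `|x - r| < d) -> forall y, X y.
Proof.
move=> p1 q1 pq ind cX inv n0 nr lim y.
pose n1 := (n`_\pi(q))%N; pose n2 := (n`_(\pi(q)^'))%N.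
have n12 : (n1 * n2 = n)%N by exact: partnC.
have n20 : (0 < n2)%N by exact: part_gt0.
have q0 : (0 < q)%N by exact: ltnW.
have cq : coprime q n2.
  by apply: (@pnat_coprime \pi(q)); [exact: pnat_pi | exact: part_pnat].
have cp : coprime p n2 by exact: coprime_dvdl pq cq.
(* The exponent [n] is large enough: a prime [l] dividing [n1] divides [q], and its multiplicity in
   [n] is less than [n]. *)
have /dvdnP[c Ec] : (n1 %| q ^ n)%N.
  apply/dvdn_partP; first exact: part_gt0.
  move=> l; rewrite mem_primes => /and3P[pl _ ln1].
  have lq : (l %| q)%N.
    have : l \in \pi(q)
      by apply: (pnatP \pi(q) (part_gt0 _ _) (part_pnat _ _) l pl ln1).
    by rewrite mem_primes => /and3P[].
  apply: dvdn_trans (dvdn_exp2r n lq).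
  rewrite p_part; apply: dvdn_exp2l; rewrite (leq_trans (n := logn l n)) //.
    by apply: dvdn_leq_log => //; exact: dvdn_part.
  by apply: ltnW; exact: ltn_logl.
pose t : R := (q ^ n)%:R.
have t0 : 0 < t by rewrite ltr0n expn_gt0 q0.
pose r' := t * r.
have n2r' : n2%:R * r' \is a Num.int.
  have -> : n2%:R * r' = c%:R * (n%:R * r).
    by rewrite /r' /t Ec -n12 !natrM; ring.
  by rewrite rpredM // natr_int.
pose u := totient n2.
have u0 : (0 < u)%N by rewrite totient_gt0.
have big m : (1 < m)%N -> (1 < m ^ u)%N.
  by move=> m1; rewrite -(exp1n u) ltn_exp2r.
have shiftX m z : (1 < m)%N -> coprime m n2 ->
    X ((m ^ u)%:R * (z + r')) -> X ((m ^ u)%:R * z + r').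
  move=> m1 cm; have /dvdnP[k E] : (n2 %| m ^ u - 1)%N.
    rewrite -eqn_mod_dvd ?(ltnW (big _ m1)) //.
    by apply/eqP; exact: Euler_exp_totient.
  have -> : (m ^ u = (k * n2).+1)%N by rewrite -E subn1 prednK // ltnW // big.
  have /intrP[a Ea] := n2r'.
  move=> /(circle_invariant_int (- (k%:Z * a)) inv).
  rewrite (_ : _ * (_ + _) + _ = (k * n2).+1%:R * z + r') //.
  by rewrite intrN intrM -Ea -pmulrn -natr1 natrM; ring.
rewrite -(subrK r' y).
apply: (@full_of_small (p ^ u) (q ^ u) [set z | X (z + r')]).
- exact: big.
- exact: big.
- exact: mult_indepX.
- exact: closed_translate.
- move=> z /= Xz; have [a1 a2 a3 a4] := circle_invariantX u inv Xz.
  split => /=; try by rewrite addrAC.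
  + exact: shiftX.
  + exact: shiftX.
- move=> d d0;
  have [x Xx /andP[x0 xd]] := lim (d / t) ltac:(by rewrite divr_gt0).
  have E : `|t * x - r'| = t * `|x - r| by rewrite -mulrBr normrM gtr0_norm.
  exists (t * x - r').
    rewrite /= subrK; apply: (circle_invariant_smooth inv _ Xx).
    by exists 0%N, n; rewrite mul1n.
  by rewrite E mulr_gt0 //= mulrC -ltr_pdivlMr.
Qed.

Lemma limit_pointR X x : limit_point X x <->
  (forall d : R, 0 < d -> exists2 y, X y & 0 < `|y - x| < d).
Proof.
split=> [lim d d0|H U /nbhs_ballP[d d0 sub]].
  have [y [yx Xy xy]] := lim _ (nbhsx_ballx x _ d0).
  exists y => //; rewrite normr_gt0 subr_eq0 yx /=.
  by move: xy; rewrite /ball /= distrC.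
have [y Xy /andP[xy yd]] := H _ d0; exists y; split => //.
  by rewrite -subr_eq0 -normr_gt0.
by apply: sub; rewrite /ball /= distrC.
Qed.

(** The limit points form a closed invariant set, nonempty by Bolzano-Weierstrass. If X is not
    everything, [full_of_rational_limit] makes them all irrational, contradicting
    [no_irrational_invariant_set]. *)
Theorem furstenberg p q X : (1 < p)%N -> (1 < q)%N -> (p %| q)%N ->
  mult_indep p q -> closed X -> circle_invariant p q X ->
  infinite_set (X `&` `[0, 1]) -> forall y, X y.
Proof.
move=> p1 q1 pq ind cX inv infX; apply: contrapT => notfull.
have irr : irrational_set (limit_point X).
  move=> x n /limit_pointR lim n0; apply/negP => nx; apply: notfull => y.
  exact: (full_of_rational_limit p1 q1 pq ind cX inv n0 nx lim).
apply: (no_irrational_invariant_set p1 q1 ind _ _ irr).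
- apply: limit_point_closed; apply: hausdorff_accessible; exact: norm_hausdorff.
- move=> x /limit_pointR lim.
  have aff a b : 0 < a -> (forall z, X z -> X (a * z + b)) ->
      limit_point X (a * x + b).
    move=> a0 aX; apply/limit_pointR => d d0.
    have [z Xz /andP[z0 zd]] := lim (d / a) ltac:(by rewrite divr_gt0).
    exists (a * z + b); first exact: aX.
    have -> : a * z + b - (a * x + b) = a * (z - x) by ring.
    by rewrite normrM gtr0_norm // mulr_gt0 //= mulrC -ltr_pdivlMr.
  split.
  + by rewrite -[x]mul1r; apply: aff => // z /inv[]; rewrite mul1r.
  + by rewrite -[x]mul1r; apply: aff => // z /inv[]; rewrite mul1r.
  + rewrite -[_ * _]addr0; apply: aff; first by rewrite ltr0n ltnW.
    by move=> z /inv[]; rewrite addr0.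
  + rewrite -[_ * _]addr0; apply: aff; first by rewrite ltr0n ltnW.
    by move=> z /inv[]; rewrite addr0.
- have [|x limx] := infinite_bounded_limit_point_nonempty infX.
    exists 1; split=> // M M1 z [_ /=]; rewrite in_itv /= => /andP[z0 z1].
    by rewrite ger0_norm // (le_trans z1) // ltW.
  exists x => U /limx[z [zx [Xz _] Uz]]; by exists z.
Qed.

End Furstenberg.

(** * Expansions *)

Section PrefixValue.
Variable s : nat.
Local Open Scope nat_scope.
Implicit Types a b : symb_seq s.

(** The first [n] symbols read as base-[s] digits, most significant first. *)
Fixpoint prefix_val a n : nat :=
  if n is n'.+1 then s * prefix_val a n' + (a n' : 'I_s) else 0.

Lemma prefix_valS a n :
  prefix_val a n.+1 = s * prefix_val a n + (a n : 'I_s).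
Proof. by []. Qed.

Lemma prefix_val_shift a n :
  prefix_val (shift s a) n + s ^ n * (a 0 : 'I_s) = prefix_val a n.+1.
Proof.
elim: n => [|n IH]; first by rewrite /= muln0 expn0 mul1n.
by rewrite [RHS]prefix_valS -IH prefix_valS expnS /shift; ring.
Qed.

(* The multiple of p that is the residue of p * a k modulo s is at most s - p, so
   adding the carry p * a k.+1 %/ s < p does not overflow. *)
Lemma mu_digit p a k : 0 < p -> p %| s ->
  (mu s p a k : 'I_s) + s * (p * (a k : 'I_s) %/ s) =
  p * (a k : 'I_s) + p * (a k.+1 : 'I_s) %/ s.
Proof.
move=> p0 /dvdnP[m Em]; have s0 := symb_seq_gt0 a; rewrite /mu /=.
move: (ltn_ord (a k.+1 : 'I_s)).
move: (nat_of_ord (a k : 'I_s)) (nat_of_ord (a k.+1 : 'I_s)) => x y ys.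
rewrite Em in ys s0 *.
have m0 : 0 < m by move: s0; rewrite muln_gt0 => /andP[].
have c_lt : p * y %/ (m * p) < p by rewrite ltn_divLR // ltn_pmul2l.
have -> : p * x %/ (m * p) = x %/ m by rewrite [m * p]mulnC divnMl.
set c := _ %/ (m * p) in c_lt *.
have xm : x %% m < m by rewrite ltn_mod.
have -> : p * x + c = x %/ m * (m * p) + (p * (x %% m) + c).
  by rewrite {1}(divn_eq x m); ring.
rewrite modnMDl modn_small; last by nia.
by ring.
Qed.

(** Weighting [mu_digit] by powers of [s] makes the carries telescope: only the one leaving the top
    digit and the one entering the bottom digit survive. *)
Lemma prefix_val_mu p a n : 0 < p -> p %| s ->
  prefix_val (mu s p a) n + s ^ n * (p * (a 0 : 'I_s) %/ s) =
  p * prefix_val a n + p * (a n : 'I_s) %/ s.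
Proof.
move=> p0 ps; elim: n => [|n IH]; first by rewrite /= muln0 expn0 mul1n.
have := mu_digit a n p0 ps; rewrite !prefix_valS.
move: (p * (a 0 : 'I_s) %/ s) (p * (a n : 'I_s) %/ s) (p * (a n.+1 : 'I_s) %/ s)
  IH => c0 c c1 /(congr1 (muln s)).
rewrite expnS !mulnDr !mulnA; lia.
Qed.

Lemma prefix_val_bounds a n k :
  prefix_val a n * s ^ k <= prefix_val a (n + k) < (prefix_val a n).+1 * s ^ k.
Proof.
elim: k => [|k IH]; first by rewrite addn0 expn0 !muln1 leqnn ltnSn.
rewrite addnS /= expnS; have := ltn_ord (a (n + k) : 'I_s).
by move: IH => /andP[]; set u := prefix_val a (n + k); nia.
Qed.

Lemma prefix_val_inj a b n : prefix_val a n = prefix_val b n ->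
  forall k, k < n -> a k = b k.
Proof.
elim: n => // n IH /= E k.
have s0 := symb_seq_gt0 a.
have Ed : prefix_val a n = prefix_val b n.
  have := congr1 (divn^~ s) E.
  by rewrite ![s * _]mulnC !divnMDl // !divn_small // !addn0.
rewrite ltnS leq_eqVlt => /orP[/eqP ->|]; last exact: IH.
by apply: val_inj; move/eqP: E; rewrite Ed eqn_add2l => /eqP.
Qed.

Lemma prefix_val_neq a b : a <> b ->
  exists k, forall n, k < n -> prefix_val a n <> prefix_val b n.
Proof.
move=> ab; have [k abk] : exists k, a k <> b k.
  by apply: contrapT => H; apply: ab; apply/funext => k;
    apply: contrapT => abk; apply: H; exists k.
by exists k => n kn E; apply: abk; exact: prefix_val_inj E _ kn.
Qed.

Local Open Scope classical_set_scope.

Lemma near_prefix_val a n : \forall b \near a, prefix_val b n = prefix_val a n.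
Proof.
elim: n => [|n IH]; first exact: filterE.
by apply: filterS2 IH (near_coord n a) => b /= -> ->.
Qed.

Lemma compact_symb_seq : compact [set: symb_seq s].
Proof.
have cD : compact [set: discrete_topology 'I_s].
  by apply: finite_compact; exact: (@finite_finset 'I_s setT).
have := @tychonoff nat (fun=> discrete_topology 'I_s) (fun=> setT) (fun=> cD).
by congr (compact _); apply/seteqP; split.
Qed.

Lemma closed_prefix_approx (A : set (symb_seq s)) b : closed A ->
  (forall n, exists2 a, A a & forall k, k < n -> a k = b k) -> A b.
Proof.
move=> cA H.
have /choice[u Hu] n : exists a, A a /\ forall k, k < n -> a k = b k.
  by have [a] := H n; exists a.
apply: (@closed_cvg _ _ \oo _ u A cA); first by apply: nearW => n;
  have [] := Hu n.
apply/cvg_sup => k U [/= _ [[V /= oV <-] /= Vb]] /filterS; apply.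
exists k.+1 => // n /= kn; move: Vb.
by rewrite /proj /= (Hu n).2.
Qed.

End PrefixValue.

Section Expansion.
Variables (R : realType) (s : nat).
Hypothesis s1 : (1 < s)%N.
Local Open Scope ring_scope.
Local Open Scope classical_set_scope.
Implicit Types a b : symb_seq s.

Let sR n : 0 < (s ^ n)%:R :> R.
Proof. by rewrite ltr0n expn_gt0 ltnW. Qed.

(** The real number 0.a0a1a2... in base [s], as the supremum of its truncations. *)
Definition expansion a : R :=
  sup (range (fun n => (prefix_val a n)%:R / (s ^ n)%:R)).

(** The intervals of numbers with a given prefix are nested, so each left end lies below each right
    end. This bounds the supremum from both sides. *)
Lemma prefix_val_ratio a m n :
  (prefix_val a m)%:R / (s ^ m)%:R <= (prefix_val a n).+1%:R / (s ^ n)%:R :> R.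
Proof.
rewrite ler_pdivrMr // mulrAC ler_pdivlMr // -!natrM ler_nat.
have [mn|/ltnW nm] := leqP m n.
  have /andP[le _] := prefix_val_bounds a m (n - m); rewrite subnKC // in le.
  have -> : (s ^ n = s ^ (n - m) * s ^ m)%N by rewrite -expnD subnK.
  by rewrite mulnA leq_mul2r (leq_trans le) ?orbT.
have /andP[_ /ltnW le] := prefix_val_bounds a n (m - n);
  rewrite subnKC // in le.
have -> : (s ^ m = s ^ (m - n) * s ^ n)%N by rewrite -expnD subnK.
by rewrite mulnA leq_mul2r le orbT.
Qed.

Lemma expansion_bounds a n :
  (prefix_val a n)%:R <= (s ^ n)%:R * expansion a <= (prefix_val a n)%:R + 1.
Proof.
rewrite natr1 mulrC -ler_pdivrMr // -[X in _ && X]ler_pdivlMr //; apply/andP;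
  split.
  apply: ub_le_sup; last by exists n.
  exists ((prefix_val a 0).+1%:R / (s ^ 0)%:R) => _ [m _ <-].
  exact: prefix_val_ratio.
apply: ge_sup; first by exists ((prefix_val a 0)%:R / (s ^ 0)%:R), 0%N.
by move=> _ [m _ <-]; exact: prefix_val_ratio.
Qed.

(** Two numbers whose difference stays bounded after scaling by [s ^ n] coincide. The bound is
    arbitrary because the carries of [mu] give an error of up to [p]. *)
Lemma expansion_unique a (x C : R) :
  (forall n, `|(s ^ n)%:R * x - (prefix_val a n)%:R| <= C) -> expansion a = x.
Proof.
move=> H; apply: contrapT => /eqP; rewrite -subr_eq0 -normr_gt0.
set d := `|_| => d0.
have Hd n : (s ^ n)%:R * d <= C + 1.
  rewrite -(gtr0_norm (sR n)) -normrM mulrBr.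
  have := H n; have /andP[] := expansion_bounds a n.
  by rewrite !ler_norml => ? ? /andP[? ?]; apply/andP; split; lra.
pose n := Num.truncn ((C + 1) / d).
have := truncnS_gt ((C + 1) / d); rewrite -/n ltr_pdivrMr // => lt.
have : (n.+1%:R : R) <= (s ^ n)%:R by rewrite ler_nat ltn_expl.
by have := Hd n; nra.
Qed.

Lemma expansion_shift a :
  expansion (shift s a) = s%:R * expansion a - (a 0%N : 'I_s)%:R.
Proof.
apply: (@expansion_unique _ _ 1) => n.
have := congr1 (fun k : nat => k%:R : R) (prefix_val_shift a n).
rewrite natrD natrM => E.
have := expansion_bounds a n.+1; rewrite -E expnSr natrM => /andP[? ?].
by rewrite ler_norml; apply/andP; split; lra.
Qed.

Lemma expansion_mu p a : (0 < p)%N -> (p %| s)%N ->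
  expansion (mu s p a) =
  p%:R * expansion a - (p * (a 0%N : 'I_s) %/ s)%:R.
Proof.
move=> p0 ps; apply: (@expansion_unique _ _ p%:R) => n.
have := congr1 (fun k : nat => k%:R : R) (prefix_val_mu a n p0 ps).
rewrite !natrD !natrM => E.
have c_le : (p * (a n : 'I_s) %/ s)%:R <= p%:R :> R.
  by rewrite ler_nat ltnW // ltn_divLR ?ltn_pmul2l // ltnW.
have c_ge0 : 0 <= (p * (a n : 'I_s) %/ s)%:R :> R by [].
have pR : 0 < p%:R :> R by rewrite ltr0n.
have := expansion_bounds a n => /andP[? ?].
have -> : (s ^ n)%:R * (p%:R * expansion a - (p * (a 0%N : 'I_s) %/ s)%:R) -
    (prefix_val (mu s p a) n)%:R =
    p%:R * ((s ^ n)%:R * expansion a - (prefix_val a n)%:R) -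
    (p * (a n : 'I_s) %/ s)%:R.
  by rewrite mulrBr; lra.
by rewrite ler_norml; apply/andP; split; nra.
Qed.

Lemma expansion_continuous : continuous expansion.
Proof.
move=> a; apply/(cvgrPdist_lt (FF := nbhs_filter a)) => e e0.
pose n := Num.truncn e^-1.
apply: filterS (near_prefix_val a n) => b E.
have /andP[a1 a2] := expansion_bounds a n;
  have /andP[b1 b2] := expansion_bounds b n.
rewrite E in b1 b2.
have := truncnS_gt e^-1; rewrite -/n -div1r ltr_pdivrMr // => lt.
have : (n.+1%:R : R) <= (s ^ n)%:R by rewrite ler_nat ltn_expl.
move=> ns; rewrite -(ltr_pM2l (sR n)) -{1}(gtr0_norm (sR n)) -normrM mulrBr.
have : n.+1%:R * e <= (s ^ n)%:R * e by rewrite ler_pM2r.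
by rewrite ltr_norml => ?; apply/andP; split; lra.
Qed.

(* For three distinct sequences and large n the three prefix values would be
   distinct integers in an interval of length 1. *)
Lemma expansion_at_most_two a b c : expansion b = expansion a ->
  expansion c = expansion a -> a <> b -> c = a \/ c = b.
Proof.
move=> ba ca ab; apply: contrapT => /not_orP[nca ncb].
have [k1 H1] := prefix_val_neq ab; have [k2 H2] := prefix_val_neq nca.
have [k3 H3] := prefix_val_neq ncb.
pose n := (k1 + k2 + k3).+1.
have := H1 n ltac:(rewrite /n; lia); have := H2 n ltac:(rewrite /n; lia).
have := H3 n ltac:(rewrite /n; lia).
have := expansion_bounds a n; have := expansion_bounds b n;
  have := expansion_bounds c n.
rewrite ba ca => /andP[c1 c2] /andP[b1 b2] /andP[a1 a2].
have close (u v : nat) (x : R) : u%:R <= x -> x <= v%:R + 1 -> (u <= v.+1)%N.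
  by move=> ux xv; rewrite -(ler_nat R) -natr1; lra.
have := close _ _ _ a1 b2; have := close _ _ _ a1 c2; have := close _ _ _ b1 a2.
have := close _ _ _ b1 c2; have := close _ _ _ c1 a2; have := close _ _ _ c1 b2.
by lia.
Qed.

Lemma finite_expansion_fiber x : finite_set [set a | expansion a = x].
Proof.
have [[a [b [ax bx ab]]]|H] := pselect (exists a b,
    [/\ expansion a = x, expansion b = x & a <> b]).
  apply: (@sub_finite_set _ _ [set a; b]); last exact: finite_set2.
  move=> c /= cx; apply: expansion_at_most_two ab; by rewrite ?ax ?bx ?cx.
have [[a ax]|H'] := pselect (exists a, expansion a = x).
  apply: (@sub_finite_set _ _ [set a]); last exact: finite_set1.
  by move=> c /= cx; apply: contrapT => ca; apply: H; exists c, a.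
apply: (@sub_finite_set _ _ set0); last exact: finite_set0.
by move=> a /= ax; apply: H'; exists a.
Qed.

Lemma infinite_invariant_full p (A : set (symb_seq s)) :
  (1 < p)%N -> (p %| s)%N -> mult_indep p s -> closed A ->
  (forall a, A a -> A (mu s p a)) -> (forall a, A a -> A (shift s a)) ->
  infinite_set A -> A = setT.
Proof.
move=> p1 ps ind cA Amu Ash infA.
(* This is the periodic set expansion(A) + Z, in the form required by [closed_translates]. *)
pose B := [set y | exists2 k, ((fun a => - expansion a) @` A) k & k + y \is a Num.int].
have BA y : B y -> exists2 a, A a & y - expansion a \is a Num.int.
  by move=> [_ [a Aa <-] ?]; exists a => //; rewrite addrC.
have AB y a : A a -> y - expansion a \is a Num.int -> B y.
  by move=> Aa ?; exists (- expansion a); [exists a | rewrite addrC].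
have cB : closed B.
  apply: (closed_translates (F := [set x : R | x \is a Num.int]));
    last exact: closed_int.
  apply: continuous_compact; last first.
    by apply: (subclosed_compact cA (@compact_symb_seq s)).
  apply: continuous_subspaceT => a;
    apply: (@continuous_comp _ _ _ expansion -%R).
    exact: expansion_continuous.
  exact: opp_continuous.
have invB : circle_invariant p s B.
  move=> y /BA[a Aa ya]; split.
  - by apply: (AB _ _ Aa); rewrite addrAC rpredD ?rpred1.
  - by apply: (AB _ _ Aa); rewrite addrAC rpredB ?rpred1.
  - apply: (AB _ _ (Amu _ Aa)); rewrite expansion_mu ?(ltnW p1) // opprB addrCA.
    by rewrite -mulrBr rpredD ?rpredM // natr_int.
  - apply: (AB _ _ (Ash _ Aa)); rewrite expansion_shift opprB addrCA.
    by rewrite -mulrBr rpredD ?rpredM // natr_int.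
have infB : infinite_set (B `&` `[0, 1]).
  (* Otherwise A would lie in a finite union of finite fibres of [expansion]. *)
  move=> finB; apply: infA.
  apply: (@sub_finite_set _ _ (\bigcup_(x in B `&` `[0, 1]) [set a | expansion a = x])).
    move=> a Aa; exists (expansion a) => //; split.
      by apply: (AB _ _ Aa); rewrite subrr rpred0.
    have := expansion_bounds a 0; rewrite /= in_itv /=.
    by rewrite mul1r add0r.
  by apply: bigcup_finite => // x _; exact: finite_expansion_fiber.
have fullB := furstenberg p1 s1 ps ind cB invB infB.
apply/seteqP; split => // b _; apply: closed_prefix_approx cA _ => n.
(* The midpoint of the interval of the prefix: as an interior point, all its expansions begin with
   that prefix. As it lies strictly between 0 and 1, the integer [m] below vanishes. *)
pose x : R := ((prefix_val b n)%:R + 2^-1) / (s ^ n)%:R.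
have [a Aa /intrP[m Em]] := BA x (fullB x); exists a => //.
have sx : (s ^ n)%:R * x = (prefix_val b n)%:R + 2^-1.
  by rewrite mulrC divfK // gt_eqF.
have x0 : 0 < x by apply: divr_gt0 => //; rewrite ltr_wpDl ?invr_gt0.
have x1 : x < 1.
  rewrite ltr_pdivrMr // mul1r.
  have /andP[_] := prefix_val_bounds b 0 n.
  rewrite add0n mul1n -(ler_nat R) -natr1; lra.
have := expansion_bounds a 0; rewrite /= mul1r add0r => /andP[a0 a1].
have m0 : m = 0.
  have : -1%:~R < m%:~R :> R by rewrite -Em; lra.
  have : m%:~R < 1%:~R :> R by rewrite -Em; lra.
  by rewrite -intrN !ltr_int; lia.
have Ea : expansion a = x by move: Em; rewrite m0 => /eqP;
  rewrite subr_eq0 => /eqP.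
have := expansion_bounds a n; rewrite Ea sx => /andP[l1 l2].
apply: prefix_val_inj; apply/eqP; rewrite eqn_leq.
by apply/andP; split; rewrite -ltnS -(ltr_nat R) -natr1; lra.
Qed.

End Expansion.

(** * Prime powers *)

Section Sparse.
Local Open Scope nat_scope.
Local Open Scope classical_set_scope.
Variables s p : nat.

Lemma invariant_generated (A : set (symb_seq s)) :
  (forall a, A a -> A (mu s p a)) -> (forall a, A a -> A (shift s a)) ->
  invariant_set (generated_semigroup [set mu s p; shift s]) A.
Proof.
move=> Amu Ash tau.
apply: (smallest_sub (C := @semigroup s) (X := [set tau | tau @` A `<=` A])).
  move=> {}tau rho tauA rhoA _ [a Aa <-] /=.
  by apply: tauA; exists (rho a) => //; apply: rhoA; exists a.
by move=> _ [->|->] _ [a Aa <-]; [exact: Amu | exact: Ash].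
Qed.

Lemma invariant_generators (A : set (symb_seq s)) :
  invariant_set (generated_semigroup [set mu s p; shift s]) A ->
  (forall a, A a -> A (mu s p a)) /\ (forall a, A a -> A (shift s a)).
Proof.
move=> inv; split=> a Aa.
  by apply: (inv (mu s p)); [by move=> M [_]; apply; left | exists a].
by apply: (inv (shift s)); [by move=> M [_]; apply; right | exists a].
Qed.

(* When s = p^e, j < e because a k < s, so p ^ j is a single base-p digit 1. *)
Definition sparse_seqs : set (symb_seq s) := [set a | forall k l,
  ((a k : 'I_s) = 0 :> nat \/ exists j, (a k : 'I_s) = p ^ j :> nat) /\
  (k <> l -> (a k : 'I_s) = 0 :> nat \/ (a l : 'I_s) = 0 :> nat)].

Lemma closed_sparse_seqs : closed sparse_seqs.
Proof.
move=> a cla k l.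
have nkl : nbhs a [set b : symb_seq s | b k = a k /\ b l = a l].
  by apply: filterS2 (near_coord k a) (near_coord l a) => b.
have [b [Sb [<- <-]]] := cla _ nkl; exact: Sb.
Qed.

Lemma sparse_seqs_shift a : sparse_seqs a -> sparse_seqs (shift s a).
Proof. by move=> Sa k l; have [S1 S2] := Sa k.+1 l.+1; split=> // kl;
  apply: S2 => -[]. Qed.

Variable e : nat.
Hypotheses (p1 : 1 < p) (e1 : 1 <= e) (s_pow : s = p ^ e).

Let s1 : 1 < s.
Proof. by rewrite s_pow (leq_trans p1) // -{1}(expn1 p) leq_exp2l. Qed.

(** The base-[p] digit 1 either moves up one place inside its cell or, from the top place, becomes
    the carry into the lowest place of the preceding cell. *)
Lemma mu_sparse_cases a k : sparse_seqs a ->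
  [\/ (mu s p a k : 'I_s) = 0 :> nat,
      [/\ (a k : 'I_s) <> 0 :> nat, p * (a k : 'I_s) < s &
          exists j, (mu s p a k : 'I_s) = p ^ j :> nat] |
      p * (a k.+1 : 'I_s) = s /\ (mu s p a k : 'I_s) = 1 :> nat].
Proof.
move=> Sa; have [S1 /(_ ltac:(lia)) S12] := Sa k k.+1; have [S2 _] := Sa k.+1 k.
rewrite /mu /=;
  move: (ltn_ord (a k : 'I_s)) (ltn_ord (a k.+1 : 'I_s)) S1 S2 S12.
move: (nat_of_ord (a k : 'I_s)) (nat_of_ord (a k.+1 : 'I_s)) => x y xs ys S1 S2 S12.
have dich z : z < s -> z = 0 \/ (exists j, z = p ^ j) -> p * z = s \/ p * z < s.
  move=> zs [->|[j Ej]]; first by right; rewrite muln0 ltnW.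
  move: zs; rewrite Ej s_pow ltn_exp2l // => je.
  have : p * p ^ j <= p ^ e by rewrite -expnS leq_exp2l.
  by rewrite leq_eqVlt => /orP[/eqP|]; [left | right].
have s0 : 0 < s by exact: ltnW.
case: S12 => E; rewrite E in S1 S2 xs ys *.
  rewrite muln0 add0n; have [Ey|lty] := dich y ys S2.
    by constructor 3; split => //; rewrite Ey divnn s0 modn_small.
  by constructor 1; rewrite divn_small // mod0n.
rewrite muln0 div0n addn0; have [Ex|ltx] := dich x xs S1.
  by constructor 1; rewrite Ex modnn.
case: S1 => [->|[j Ej]]; first by constructor 1; rewrite muln0 mod0n.
constructor 2; split => //.
  by rewrite Ej; apply/eqP; rewrite expn_eq0 -leqn0 leqNgt ltnW.
by exists j.+1; rewrite modn_small // Ej expnS.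
Qed.

(** A nonzero cell of the image comes from a nonzero cell of [a] at the same index or the next;
    whether [p] times its value is below [s] or equal to [s] decides which. Two nonzero image cells
    would thus require two in [a]. *)
Lemma sparse_seqs_mu a : sparse_seqs a -> sparse_seqs (mu s p a).
Proof.
move=> Sa k l; split.
  case: (mu_sparse_cases k Sa) => [->|[_ _ Ej]|[_ E]]; [by left | by right |].
  by right; exists 0; rewrite expn0.
have nz x : p * x = s -> x <> 0 by move=> E x0; move: s1; rewrite -E x0 muln0.
move=> kl; case: (mu_sparse_cases k Sa) => [Ek|[k0 ks _]|[ks _]]; first by left.
  case: (mu_sparse_cases l Sa) => [El|[l0 _ _]|[ls _]]; first by right.
    by have [_ /(_ kl)[]] := Sa k l.
  have [kl'|kl'] := eqVneq k l.+1; first by move: ks; rewrite kl' ls ltnn.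
  by have [_ /(_ (elimN eqP kl'))[|/(nz _ ls)]] := Sa k l.+1.
case: (mu_sparse_cases l Sa) => [El|[l0 lts _]|[ls _]]; first by right.
  have [kl'|kl'] := eqVneq k.+1 l; first by move: lts; rewrite -kl' ks ltnn.
  by have [_ /(_ (elimN eqP kl'))[/(nz _ ks)|]] := Sa k.+1 l.
by have [_ /(_ ltac:(by case))[/(nz _ ks)|/(nz _ ls)]] := Sa k.+1 l.+1.
Qed.

Let digit0 : 'I_s := Ordinal (ltnW s1).
Let digit1 : 'I_s := Ordinal s1.
Definition unit_seq n : symb_seq s :=
  fun k => if k == n then digit1 else digit0.

Lemma infinite_sparse_seqs : infinite_set sparse_seqs.
Proof.
move=> fin; apply: infinite_nat.
apply: sub_finite_set (finite_preimage (f := unit_seq) _ fin).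
  move=> n _ k l; rewrite /= /unit_seq; split.
    by case: eqP => _; [right; exists 0; rewrite expn0 | left].
  case: (k =P n) => [-> nl|]; last by left.
  by right; case: (l =P n) nl => // ->.
move=> m n _ _ /(congr1 (fun a : symb_seq s => a m)); rewrite /unit_seq eqxx.
by case: eqP => // _ /(congr1 val).
Qed.

Lemma sparse_seqs_neqT : sparse_seqs <> setT.
Proof.
move=> E; have : sparse_seqs (fun=> digit1) by rewrite E.
by move=> /(_ 0 1)[_ []].
Qed.

Lemma prime_power_not_ID :
  ~ ID (generated_semigroup [set mu s p; shift s]).
Proof.
move=> idP; apply: infinite_sparse_seqs; apply: idP.
- exact: closed_sparse_seqs.
- apply: invariant_generated;
  [exact: sparse_seqs_mu | exact: sparse_seqs_shift].
- by split => // sub; apply: sparse_seqs_neqT; apply/seteqP; split.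
Qed.

End Sparse.

(** * Multiplicative independence and the equivalence *)

Lemma mult_indep_prime p s : prime p -> (1 < s)%N ->
  ~ (exists q k : nat, [/\ prime q, (1 <= k)%N & s = (q ^ k)%N]) ->
  mult_indep p s.
Proof.
move=> pp s1 notpow a b E.
have [b0|b0] := posnP b.
  move/eqP: E; rewrite b0 expn0 -(expn0 p) eqn_exp2l ?prime_gt1 //.
  by move/eqP.
(* A divisor of a power of the prime [p] is itself a power of [p]. *)
have : (s %| p ^ a)%N by rewrite E dvdn_exp.
move/(dvdn_pfactor _ _ pp) => [k _ Es].
case: notpow; exists p, k; split => //.
by case: k Es s1 => // ->.
Qed.

Local Open Scope nat_scope.
Local Open Scope classical_set_scope.

Theorem theorem2p2 (s : nat) (hs : 2 <= s)
    (d : nat) (p e : 'I_d -> nat)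
    (p_prime : forall i, prime (p i))
    (p_distinct : injective p)
    (e_ge1 : forall i, 1 <= e i)
    (s_decomp : s = \prod_(i < d) p i ^ e i) :
  forall i : 'I_d,
    ID (generated_semigroup [set mu s (p i); shift s]) <->
    ~ (exists q k : nat, [/\ prime q, 1 <= k & s = q ^ k]).
Proof.
move=> i; have pi_s : p i %| s.
  rewrite s_decomp (bigD1 i) //= dvdn_mulr // -{1}(expn1 (p i)).
  exact: dvdn_exp2l.
split.
  move=> idP [q [k [qp k1 Es]]].
  have Epq : p i = q.
    move: pi_s; rewrite Es (Euclid_dvdX _ _ (p_prime i)) => /andP[+ _].
    by rewrite (dvdn_prime2 (p_prime i) qp) => /eqP.
  by apply: (@prime_power_not_ID s (p i) k) idP; rewrite ?prime_gt1 // Epq.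
move=> notpow A cA inv AT; apply: contrapT => infA.
have [Amu Ash] := invariant_generators inv.
have p1 := prime_gt1 (p_prime i).
have ind := mult_indep_prime (p_prime i) hs notpow.
(* The result holds over any [realType]; the standard reals provide an instance. *)
have := infinite_invariant_full Rdefinitions.R hs p1 pi_s ind cA Amu Ash infA.
by move=> AE; move: AT; rewrite AE => -[_]; apply.
Qed.
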